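(* Let $\boldsymbol{\rho}=(\rho_1,\dots,\rho_m)$ and $\boldsymbol{\tau}=(\tau_1,\dots,\tau_n)$ be two contraction vectors. Then the following two conditions are equivalent: (a) there exist positive integers $p,q$ such that $$\mathrm{sgp}(\rho_1^p,\dots,\rho_m^p)\subseteq \mathrm{sgp}(\tau_1,\dots,\tau_n)\quad\text{and}\quad \mathrm{sgp}(\tau_1^q,\dots,\tau_n^q)\subseteq \mathrm{sgp}(\rho_1,\dots,\rho_m);$$ (b) $V^+_{\boldsymbol{\rho}}=V^+_{\boldsymbol{\tau}}$.
   Context: Fix an integer $d\ge 1$ (the dimension of the ambient space $\mathbb{R}^d$). A contraction vector is a vector $\boldsymbol{\rho}=(\rho_1,\dots,\rho_m)$ with $\rho_1,\dots,\rho_m\in(0,1)$ and $\sum_{j=1}^m\rho_j^d<1$. For positive real numbers $a_1,\dots,a_m$, $\mathrm{sgp}(a_1,\dots,a_m)$ denotes the multiplicative semigroup generated by $a_1,\dots,a_m$. $\mathbb{Q}^+$ denotes the set of non-negative rational numbers, and for a contraction vector $\boldsymbol{\rho}=(\rho_1,\dots,\rho_m)$, $$V^+_{\boldsymbol{\rho}}=\mathbb{Q}^+\log\rho_1+\cdots+\mathbb{Q}^+\log\rho_m=\Big\{\sum_{i=1}^m q_i\log\rho_i:\ q_i\in\mathbb{Q}^+\Big\}\subset\mathbb{R}.$$ *)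

(* Defs.v *)
From HB Require Import structures.
From mathcomp Require Import all_boot all_order all_algebra.
From mathcomp Require Import all_classical all_reals all_analysis.

Set Implicit Arguments.
Unset Strict Implicit.
Unset Printing Implicit Defensive.

Import Order.TTheory GRing.Theory Num.Theory.

Local Open Scope classical_set_scope.
Local Open Scope ring_scope.

Definition contraction_vector (R : realType) (d m : nat) (rho : 'I_m -> R) : Prop :=
  (forall i, 0 < rho i < 1) /\ \sum_(i < m) rho i ^+ d < 1.

Definition mul_closed_set (R : realType) (S : set R) : Prop :=
  forall x y, S x -> S y -> S (x * y).

(* A semigroup, not a monoid: 1 is a member only if it is a product of one or
   more of the [a i]. *)
Definition sgp (R : realType) (m : nat) (a : 'I_m -> R) : set R :=
  smallest (@mul_closed_set R) (range a).

Definition Vplus (R : realType) (m : nat) (rho : 'I_m -> R) : set R :=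
  [set x | exists q : 'I_m -> rat,
     (forall i, 0 <= q i) /\ x = \sum_(i < m) ratr (q i) * ln (rho i)].

(* Main.v *)
Require Import Defs.
From HB Require Import structures.
From mathcomp Require Import all_boot all_order all_algebra.
From mathcomp Require Import all_classical all_reals all_analysis.
Import Order.TTheory GRing.Theory Num.Theory.
Local Open Scope classical_set_scope.
Local Open Scope ring_scope.

(** The logarithm turns products of powers of the [tau j] into combinations of
    the [ln (tau j)] with natural coefficients, and the equivalence splits into
    two symmetric halves, each saying that some power [p > 0] sends the
    semigroup of [rho] into that of [tau] iff the cone of [rho] lies in the cone
    of [tau] ([sgp_expn_subset_iff]).

    From semigroups to cones: an element of [sgp tau] has its logarithm in
    [Vplus tau] ([ln_sgp]), so [p * ln (rho i)] lies in that cone; dividing by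
    [p], so does [ln (rho i)], and these generate [Vplus rho].

    From cones to semigroups: each [ln (rho i)] is a nonnegative rational
    combination of the [ln (tau j)].  A common denominator [p] of all the
    coefficients ([common_denominator]) makes [rho i ^+ p] a monomial in the
    [tau j].  Such a monomial is in [sgp tau] unless it equals [1]
    ([monomial_sgp]), and that is excluded because [rho i ^+ p < 1]. *)

Lemma VplusD (R : realType) (n : nat) (tau : 'I_n -> R) (x y : R) :
  Vplus tau x -> Vplus tau y -> Vplus tau (x + y).
Proof.
move=> [q [q0 ->]] [r [r0 ->]]; exists (fun j => q j + r j); split.
  by move=> j; rewrite addr_ge0.
by rewrite -big_split; apply: eq_bigr => j _; rewrite rmorphD mulrDl.
Qed.

Lemma VplusZ (R : realType) (n : nat) (tau : 'I_n -> R) (c : rat) (x : R) :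
  0 <= c -> Vplus tau x -> Vplus tau (ratr c * x).
Proof.
move=> c0 [q [q0 ->]]; exists (fun j => c * q j); split.
  by move=> j; rewrite mulr_ge0.
by rewrite mulr_sumr; apply: eq_bigr => j _; rewrite rmorphM mulrA.
Qed.

Lemma Vplus0 (R : realType) (n : nat) (tau : 'I_n -> R) : Vplus tau 0.
Proof.
exists (fun=> 0); split=> //.
by rewrite big1 // => j _; rewrite rmorph0 mul0r.
Qed.

Lemma Vplus_ln (R : realType) (n : nat) (tau : 'I_n -> R) (j : 'I_n) :
  Vplus tau (ln (tau j)).
Proof.
exists (fun k => (k == j)%:R); split; first by move=> k; rewrite ler0n.
rewrite (bigD1 j) //= eqxx rmorph1 mul1r big1 ?addr0 // => k /negPf ->.
by rewrite rmorph0 mul0r.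
Qed.

Lemma Vplus_subset_gen (R : realType) (m n : nat)
    (rho : 'I_m -> R) (tau : 'I_n -> R) :
  (forall i, Vplus tau (ln (rho i))) -> Vplus rho `<=` Vplus tau.
Proof.
move=> gen x [q [q0 ->]].
apply: (big_ind (Vplus tau)); [exact: Vplus0|exact: VplusD|].
by move=> i _; exact: VplusZ.
Qed.

Lemma sgpM (R : realType) (n : nat) (tau : 'I_n -> R) (x y : R) :
  sgp tau x -> sgp tau y -> sgp tau (x * y).
Proof. by move=> Sx Sy S SP; apply: SP.1; [exact: Sx|exact: Sy]. Qed.

Lemma sgp_gen (R : realType) (n : nat) (tau : 'I_n -> R) (j : 'I_n) :
  sgp tau (tau j).
Proof. by move=> S [_ St]; apply: St; exists j. Qed.

(** Positivity is carried along because [ln] is additive only on positive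
    reals; the pair of properties is closed under products. *)
Lemma ln_sgp (R : realType) (n : nat) (tau : 'I_n -> R) (x : R) :
  (forall j, 0 < tau j) -> sgp tau x -> 0 < x /\ Vplus tau (ln x).
Proof.
move=> tau0 Sx; apply: (Sx [set y | 0 < y /\ Vplus tau (ln y)]); split.
  move=> y z [y0 Vy] [z0 Vz]; split; first exact: mulr_gt0.
  by rewrite lnM ?posrE //; exact: VplusD.
by move=> _ [j _ <-]; split; [exact: tau0|exact: Vplus_ln].
Qed.

Lemma ln_monomial (R : realType) (n : nat) (tau : 'I_n -> R)
    (k : 'I_n -> nat) :
  (forall j, 0 < tau j) ->
  ln (\prod_(j < n) tau j ^+ k j) = \sum_(j < n) (k j)%:R * ln (tau j).
Proof.
move=> tau0; pose P (x y : R) := 0 < x /\ ln x = y.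
suff [] : P (\prod_(j < n) tau j ^+ k j) (\sum_(j < n) (k j)%:R * ln (tau j)).
  by [].
apply: (big_ind2 P) => [|x1 y1 x2 y2 [x10 <-] [x20 <-]|j _].
- by split; [exact: ltr01|exact: ln1].
- by split; [exact: mulr_gt0|rewrite lnM ?posrE].
- by split; [rewrite exprn_gt0|rewrite lnXn // -(mulr_natl (ln _))].
Qed.

(** Adjoining [1] to the semigroup gives a monoid, which is stable under
    powers with arbitrary natural exponents and under finite products. *)
Lemma monomial_sgp (R : realType) (n : nat) (tau : 'I_n -> R)
    (k : 'I_n -> nat) :
  let x := \prod_(j < n) tau j ^+ k j in x = 1 \/ sgp tau x.
Proof.
pose M (x : R) := x = 1 \/ sgp tau x.
have MM x y : M x -> M y -> M (x * y).
  move=> [->|Sx]; first by rewrite mul1r.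
  by move=> [->|Sy]; right; [rewrite mulr1|exact: sgpM].
apply: (big_ind M) => // [|j _]; first by left.
elim: (k j) => [|e IHe]; first by left; rewrite expr0.
by rewrite exprS; apply: MM => //; right; exact: sgp_gen.
Qed.

Lemma common_denominator (I : finType) (q : I -> rat) :
  (forall i, 0 <= q i) ->
  exists p (k : I -> nat), (0 < p)%N /\ forall i, p%:R * q i = (k i)%:R.
Proof.
move=> q0; pose D i := `|denq (q i)|%N.
exists (\prod_i D i)%N.
exists (fun i => (`|numq (q i)| * \prod_(j | j != i) D j)%N); split.
  by rewrite prodn_gt0 // => i; rewrite absz_gt0 denq_neq0.
move=> i; rewrite (bigD1 i) //= !natrM mulrAC; congr (_ * _).
rewrite -[in LHS](divq_num_den (q i)) mulrC !natr_absz.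
rewrite (ger0_norm (denq_ge0 _)) ger0_norm ?numq_ge0 //.
by rewrite divfK // intr_eq0 denq_neq0.
Qed.

Lemma sgp_expn_subset_iff (R : realType) (m n : nat)
    (rho : 'I_m -> R) (tau : 'I_n -> R) :
  (forall i, 0 < rho i < 1) -> (forall j, 0 < tau j) ->
  (exists2 p, (0 < p)%N & sgp (fun i => rho i ^+ p) `<=` sgp tau)
  <-> Vplus rho `<=` Vplus tau.
Proof.
move=> rho01 tau0; have rho0 i : 0 < rho i by have /andP[] := rho01 i.
split=> [[p p0 sub]|sub].
  apply: Vplus_subset_gen => i.
  have [_] := ln_sgp _ _ _ _ tau0 (sub _ (sgp_gen _ _ (fun i => rho i ^+ p) i)).
  rewrite lnXn // => Vp.
  have -> : ln (rho i) = ratr p%:R^-1 * (ln (rho i) *+ p).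
    by rewrite fmorphV /= ratr_nat -(mulr_natl (ln _)) mulKf // pnatr_eq0 -lt0n.
  by apply: VplusZ => //; rewrite invr_ge0 ler0n.
have /fin_all_exists[q qP] i : exists q : 'I_n -> rat, (forall j, 0 <= q j) /\
    ln (rho i) = \sum_(j < n) ratr (q j) * ln (tau j).
  exact/sub/Vplus_ln.
(* A single exponent has to serve all [i] at once, hence the pairs. *)
have [|p [k [p0 kP]]] := common_denominator _ (fun ij => q ij.1 ij.2).
  by move=> ij; have [] := qP ij.1.
exists p => //.
have rhoE i : rho i ^+ p = \prod_(j < n) tau j ^+ k (i, j).
  apply: ln_inj; rewrite ?posrE ?exprn_gt0 //.
    by apply: prodr_gt0 => j _; rewrite exprn_gt0.
  rewrite lnXn // -(mulr_natl (ln _)) (qP i).2 mulr_sumr.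
  rewrite ln_monomial //; apply: eq_bigr => j _; rewrite mulrA.
  by rewrite -(ratr_nat R p) -rmorphM /= (kP (i, j)) ratr_nat.
move=> x Sx; apply: (Sx (sgp tau)); split; first exact: sgpM.
move=> _ [i _ <-]; have := monomial_sgp _ _ tau (fun j => k (i, j)).
rewrite /= -rhoE => -[rho1|//].
have /andP[_ rho_lt1] := rho01 i.
by have := exprn_ilt1 p (ltW (rho0 i)) rho_lt1; rewrite rho1 ltxx -lt0n p0.
Qed.

Theorem theorem1p2 (R : realType) (d : nat) (hd : (1 <= d)%N) (m n : nat)
    (rho : 'I_m -> R) (tau : 'I_n -> R)
    (hrho : contraction_vector d rho) (htau : contraction_vector d tau) :
  (exists p q : nat,
     [/\ (0 < p)%N, (0 < q)%N,
         sgp (fun i => rho i ^+ p) `<=` sgp tau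
       & sgp (fun j => tau j ^+ q) `<=` sgp rho])
  <-> Vplus rho = Vplus tau.
Proof.
have [rho01 _] := hrho; have [tau01 _] := htau.
have rho0 i : 0 < rho i by have /andP[] := rho01 i.
have tau0 j : 0 < tau j by have /andP[] := tau01 j.
have [rt tr] := sgp_expn_subset_iff _ _ _ _ _ rho01 tau0.
have [tr' rt'] := sgp_expn_subset_iff _ _ _ _ _ tau01 rho0.
split=> [[p [q [p0 q0 subp subq]]]|VE].
  by apply/seteqP; split; [apply: rt; exists p|apply: tr'; exists q].
have [|p p0 subp] := tr; first by rewrite VE.
have [|q q0 subq] := rt'; first by rewrite VE.
by exists p, q.
Qed.
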